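(* Let $X$ be a $2$-neighbourly simplicial complex of dimension $d$ on $m$ vertices. Then, with respect to any field $\mathbb{F}$, the mu-vector of $X$ is given by $$\mu_i=\frac1m\sum_{j=1}^{m}\frac{1}{\binom{m-1}{j-1}}\ \sum_{\substack{A\subseteq B\subseteq V(X)\\ \#(B)=j,\ \#(B\setminus A)=1}}\beta_i(X[B],X[A]),\qquad 0\le i\le d.$$
   Context: All simplicial complexes are finite and abstract, and the empty set is a face of each. $V(X)$ is the vertex set of $X$; for a set $A$, $X[A]=\{\alpha\in X:\alpha\subseteq A\}$ is the induced subcomplex of $X$ on $A\cap V(X)$. $X$ is $2$-neighbourly if any two vertices of $X$ form a face of $X$. The link of a vertex $x$ is $\mathrm{lk}_X(x)=\{\alpha\in X: x\notin\alpha,\ \alpha\cup\{x\}\in X\}$. Homology is simplicial with coefficients in $\mathbb{F}$; $\beta_i(X)=\dim_{\mathbb F}H_i(X;\mathbb F)$ and, for a subcomplex $Y$ of $X$, $\beta_i(X,Y)=\dim_{\mathbb F}H_i(X,Y;\mathbb F)$ (unreduced relative homology). Reduced Betti numbers: $\widetilde\beta_i=\beta_i$ for $i\ne0$, $\widetilde\beta_0=\beta_0-1$; in particular, for the complex $\emptyset$ whose only face is the empty set, $\widetilde\beta_0(\emptyset)=-1$ and $\widetilde\beta_i(\emptyset)=0$ for $i\neq 0$. For a complex $X$ with $m$ vertices, the sigma-vector has components $$\sigma_i(X)=\sum_{j=0}^{m}\frac{1}{\binom mj}\sum_{A\subseteq V(X),\ \#(A)=j}\widetilde\beta_i(X[A])$$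 (this formula being used for every $i\ge 0$). If $\dim X=d$, the mu-vector $(\mu_0,\dots,\mu_d)$ of $X$ is given by $\mu_0(X)=1$ and $$\mu_i(X)=\delta_{i1}+\frac1m\sum_{x\in V(X)}\sigma_{i-1}(\mathrm{lk}_X(x)),\quad 1\le i\le d,$$ where $\delta$ is the Kronecker delta. *)

(* Defs.v *)
From HB Require Import structures.
From mathcomp Require Import all_boot all_order all_algebra.

Set Implicit Arguments.
Unset Strict Implicit.
Unset Printing Implicit Defensive.

Import Order.TTheory GRing.Theory Num.Theory.
Local Open Scope ring_scope.

Section Complexes.
Variable T : finType.
Implicit Types (X Y : {set {set T}}) (A a b : {set T}).

Definition simplicial_complex X : Prop :=
  set0 \in X /\ forall a b, a \in X -> b \subset a -> b \in X.

(* The ambient type T may contain points that are not vertices of X. *)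
Definition vertices X : {set T} := [set x | [set x] \in X].

(* The complex whose only face is the empty set has dimension -1. *)
Definition dim_complex X : int := (\max_(a in X) #|a|)%:Z - 1.

Definition induced X A : {set {set T}} := [set a in X | a \subset A].

Definition link X (x : T) : {set {set T}} :=
  [set a in X | (x \notin a) && (x |: a \in X)].

Definition neighbourly2 X : Prop :=
  forall x y, x \in vertices X -> y \in vertices X -> [set x; y] \in X.

End Complexes.

Section Homology.
Variables (F : fieldType) (T : finType).
Implicit Types (X Y : {set {set T}}) (a b : {set T}).

(* The simplicial chains of all degrees live in one space of functions; a
   set a of n.+1 points stands for the n-simplex whose vertices are listed in
   increasing order of enum_rank. *)
Definition chain : vectType F := {ffun {set T} -> F^o}.

Definition simplex a : chain := [ffun b => (b == a)%:R].

Definition position a (x : T) : nat :=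
  #|[set y in a | (enum_rank y < enum_rank x)%N]|.

(* Simplices of dimension 0 are sent to 0: the chain complex is not
   augmented, and the homology is unreduced. *)
Definition boundary_fun (c : chain) : chain :=
  \sum_(a : {set T} | (1 < #|a|)%N)
     (c a : F) *: \sum_(x in a) (-1) ^+ position a x *: simplex (a :\ x).

Fact boundary_fun_is_linear : linear boundary_fun.
Proof.
move=> k u v; rewrite /boundary_fun scaler_sumr -big_split /=.
by apply: eq_bigr => a _; rewrite !ffunE scalerDl scalerA.
Qed.

HB.instance Definition _ :=
  GRing.isLinear.Build F chain chain _ boundary_fun boundary_fun_is_linear.

Definition boundary : 'End(chain) := linfun boundary_fun.

Definition chains X (i : nat) : {vspace chain} :=
  <<[seq simplex a | a <- enum X & #|a| == i.+1]>>%VS.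

Definition cycles X i : {vspace chain} := (chains X i :&: lker boundary)%VS.
Definition boundaries X i : {vspace chain} := (boundary @: chains X i.+1)%VS.

(* Boundaries are cycles, so the truncated subtractions here and in rel_betti
   are exact whenever X is a complex and Y a subcomplex of X. *)
Definition betti X i : nat := (\dim (cycles X i) - \dim (boundaries X i))%N.

(* H_i(X, Y) is the space of relative cycles (chains of X whose boundary is a
   chain of Y) modulo the relative boundaries (boundaries of X plus chains
   of Y). For i = 0 the index i.-1 = 0 is harmless, since the boundary of a
   0-chain is 0. *)
Definition rel_cycles X Y i : {vspace chain} :=
  (chains X i :&: boundary @^-1: chains Y i.-1)%VS.
Definition rel_boundaries X Y i : {vspace chain} :=
  (boundaries X i + chains Y i)%VS.

Definition rel_betti X Y i : nat :=
  (\dim (rel_cycles X Y i) - \dim (rel_boundaries X Y i))%N.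

(* In degree 0 this is -1 on the complex whose only face is the empty set. *)
Definition reduced_betti X i : int := (betti X i)%:Z - (i == 0%N)%:Z.

End Homology.

Section Vectors.
Variables (F : fieldType) (T : finType).
Implicit Types X : {set {set T}}.

Definition sigma X (i : nat) : rat :=
  let m := #|vertices X| in
  \sum_(0 <= j < m.+1) ('C(m, j)%:R)^-1 *
    \sum_(A : {set T} | (A \subset vertices X) && (#|A| == j))
       (reduced_betti F (induced X A) i)%:~R.

Definition mu X (i : nat) : rat :=
  if i is k.+1 then
    (i == 1%N)%:R
      + (#|vertices X|%:R)^-1 * \sum_(x in vertices X) sigma (link X x) k
  else 1.

End Vectors.

(* Main.v *)
From HB Require Import structures.
Require Import Defs.
From mathcomp Require Import all_boot all_order all_algebra.

Import Order.TTheory GRing.Theory Num.Theory.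
Local Open Scope ring_scope.

(** Fix a vertex [x] and a set [A] of other vertices. The simplices of X[A + x]
that are not in X[A] are the sets [x |: a] with [a] in the complex
L = lk_X(x)[A], so the quotient of chain complexes that computes
H(X[A + x], X[A]) is, up to a shift of degree by one and signs, the
augmented chain complex of L. Hence H_(i+1)(X[A + x], X[A]) is the reduced
homology H_i(L), for every [i >= -1] (the usual excision of the star of [x]).
This is [rel_betti_link] in positive degrees and [rel_betti0_deletion] in
degree 0; they are obtained by transporting relative cycles and relative
boundaries through the linear map [link_part x], which sends the simplex
[x |: a] to plus or minus [a], kills the simplices that avoid [x], and
anticommutes with the boundary ([link_part_boundary]).

Summing over the pairs (B, A) with [B = x |: A] is the same as summing over
[x] and then over A inside V(X) - x ([sum_codim1_pairs]), with the weights of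
the sigma-vector of lk_X(x): as X is 2-neighbourly, the link has all the
vertices other than [x], and L has vertex set A. The two sides therefore agree
term by term, except where A is empty. There the unreduced convention
(reduced beta_0 of the empty complex is -1, instead of reduced beta_(-1) being
1) makes the term of sigma_0 smaller by 1 than the relative Betti number; the
average of these defects over [x] is the Kronecker delta in mu_1. In degree 0
the relative Betti number is 1 for empty A and 0 otherwise, whose average is
mu_0 = 1. *)

Set Implicit Arguments.
Unset Strict Implicit.
Unset Printing Implicit Defensive.

(** * Chains, the augmented boundary and the link part of a chain *)

Section Chains.
Variables (F : fieldType) (T : finType).
Local Notation chain := (chain F T).
Local Notation simplex := (@simplex F T).
Implicit Types (X Y : {set {set T}}) (a b : {set T}) (c : chain).

Lemma chain_simplexE c : c = \sum_a (c a : F) *: simplex a.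
Proof.
apply/ffunP => b; rewrite sum_ffunE (bigD1 b) //= !ffunE eqxx [_ *: _]mulr1.
rewrite big1 ?addr0 // => a nab; rewrite !ffunE eq_sym (negPf nab).
exact: mulr0.
Qed.

Lemma eq_lfun_simplex (V : vectType F) (f g : 'Hom(chain, V)) :
  (forall a, f (simplex a) = g (simplex a)) -> f = g.
Proof.
move=> fg; apply/lfunP => c; rewrite (chain_simplexE c) !linear_sum.
by apply: eq_bigr => a _; rewrite !linearZ /= fg.
Qed.

Lemma sum_simplex_coef (V : lmodType F) (P : pred {set T})
    (g : {set T} -> V) a :
  \sum_(b | P b) (simplex a b : F) *: g b = if P a then g a else 0.
Proof.
rewrite big_mkcond (bigD1 a) //= ffunE eqxx scale1r big1 ?addr0 // => b nba.
by rewrite ffunE (negPf nba) scale0r if_same.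
Qed.

(** The spanning family of [chains X i] consists of indicator functions, so
membership is a condition on the support alone. *)
Lemma chainsP X i c :
  reflect (forall a, c a != 0 -> (a \in X) && (#|a| == i.+1))
          (c \in chains F X i).
Proof.
apply: (iffP idP) => [|cX].
  rewrite /chains -[map _ _]in_tupleE => /coord_span -> a.
  apply: contraR => aX; rewrite sum_ffunE big1 // => k _.
  have /mapP[b] := mem_nth 0 (ltn_ord k).
  rewrite mem_filter mem_enum => /andP[bi bX] ->.
  rewrite !ffunE; case: eqP => [ab|_]; last exact: mulr0.
  by rewrite ab bX bi in aX.
rewrite (chain_simplexE c); apply: memv_suml => a _.
have [->|/cX/andP[aX ai]] := eqVneq (c a) 0; first by rewrite scale0r mem0v.
by apply/memvZ/memv_span/map_f; rewrite mem_filter ai mem_enum.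
Qed.

Lemma simplex_chains X i a :
  a \in X -> #|a| = i.+1 -> simplex a \in chains F X i.
Proof.
move=> aX ai; apply/chainsP => b; rewrite ffunE.
by case: (b =P a) => [->|_]; rewrite ?eqxx // aX ai eqxx.
Qed.

Lemma chains_subvP X i (U : {vspace chain}) :
  (forall a, a \in X -> #|a| = i.+1 -> simplex a \in U) ->
  (chains F X i <= U)%VS.
Proof.
move=> XU; apply/span_subvP => _ /mapP[a + ->].
by rewrite mem_filter mem_enum => /andP[/eqP ai aX]; apply: XU.
Qed.

Lemma chainsS X Y i : X \subset Y -> (chains F X i <= chains F Y i)%VS.
Proof.
by move=> /subsetP XY; apply: chains_subvP => a /XY aY; apply: simplex_chains.
Qed.

Lemma boundary_simplex a :
  boundary F T (simplex a) =
    if (1 < #|a|)%N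
    then \sum_(x in a) (-1) ^+ position a x *: simplex (a :\ x) else 0.
Proof. by rewrite lfunE /= /boundary_fun sum_simplex_coef. Qed.

Lemma boundary_chains X i c :
  simplicial_complex X -> c \in chains F X i.+1 ->
  boundary F T c \in chains F X i.
Proof.
move=> [_ Xsub] cX.
suff /subvP/(_ c cX): (chains F X i.+1 <= boundary F T @^-1: chains F X i)%VS.
  by rewrite -memv_preim.
apply: chains_subvP => a aX ai; rewrite -memv_preim boundary_simplex ai.
apply: memv_suml => x xa; apply/memvZ/simplex_chains.
  exact: Xsub aX (subD1set a x).
by apply/eqP; rewrite -eqSS -ai (cardsD1 x a) xa.
Qed.

(** Without the cardinality condition of [boundary_fun], a vertex is sent to
the empty simplex: this is the boundary of the augmented chain complex. It is
the boundary for which [link_part_boundary] holds in every degree. *)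
Definition aug_boundary_fun c : chain :=
  \sum_a (c a : F) *: \sum_(x in a) (-1) ^+ position a x *: simplex (a :\ x).

Fact aug_boundary_fun_is_linear : linear aug_boundary_fun.
Proof.
move=> k u v; rewrite /aug_boundary_fun scaler_sumr -big_split /=.
by apply: eq_bigr => a _; rewrite !ffunE scalerDl scalerA.
Qed.

HB.instance Definition _ :=
  GRing.isLinear.Build F chain chain _ aug_boundary_fun
    aug_boundary_fun_is_linear.

Definition aug_boundary : 'End(chain) := linfun aug_boundary_fun.

Lemma aug_boundary_simplex a :
  aug_boundary (simplex a) =
    \sum_(x in a) (-1) ^+ position a x *: simplex (a :\ x).
Proof. by rewrite lfunE /= /aug_boundary_fun sum_simplex_coef. Qed.

Lemma aug_boundary_chains X i c :
  c \in chains F X i.+1 -> aug_boundary c = boundary F T c.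
Proof.
move=> cX; apply/eqP; rewrite -subr_eq0 -opp_lfunE -add_lfunE -memv_ker.
apply: subvP cX; apply: chains_subvP => a _ ai.
by rewrite memv_ker add_lfunE opp_lfunE boundary_simplex aug_boundary_simplex
  ai subrr.
Qed.

Lemma position_set1 (x : T) : position [set x] x = 0%N.
Proof.
by apply: eq_card0 => y; rewrite !inE; case: eqP => // ->; rewrite ltnn.
Qed.

Lemma aug_boundary_vertex x :
  aug_boundary (simplex [set x]) = simplex set0.
Proof.
by rewrite aug_boundary_simplex big_set1 setDv position_set1 scale1r.
Qed.

Lemma position_setD1 a x y :
  y \in a ->
  position a x = ((enum_rank y < enum_rank x) + position (a :\ y) x)%N.
Proof.
move=> ya; rewrite /position (cardsD1 y) !inE ya /=; congr (_ + _)%N.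
by apply: eq_card => z; rewrite !inE andbA.
Qed.

(** The sign identity behind the square of the boundary being zero: exactly one
of [x], [y] precedes the other, so exactly one of the two positions drops when
the other point is removed. *)
Lemma position_swap a x y : x \in a -> y \in a -> x != y ->
  (-1) ^+ (position a y + position (a :\ y) x) =
    - (-1) ^+ (position a x + position (a :\ x) y) :> F.
Proof.
move=> xa ya nxy; rewrite (position_setD1 y xa) (position_setD1 x ya) !exprD.
have: enum_rank x != enum_rank y by rewrite (inj_eq enum_rank_inj).
rewrite -val_eqE /=; set p := (-1) ^+ position (a :\ x) y.
set q := (-1) ^+ position (a :\ y) x.
by case: ltngtP => // _ _; rewrite expr0 expr1 mulN1r mul1r mulNr ?opprK mulrC.
Qed.

(** The projection of chains onto chains modulo the simplices avoiding [x],
followed by the identification of [a] with its face opposite to [x]. The sign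
moves [x] to the front of [a]. *)
Definition link_part_fun (x : T) c : chain :=
  \sum_(a : {set T} | x \in a)
    (c a : F) *: ((-1) ^+ position a x *: simplex (a :\ x)).

Fact link_part_fun_is_linear x : linear (link_part_fun x).
Proof.
move=> k u v; rewrite /link_part_fun scaler_sumr -big_split /=.
by apply: eq_bigr => a _; rewrite !ffunE scalerDl (scalerA k).
Qed.

HB.instance Definition _ x :=
  GRing.isLinear.Build F chain chain _ (link_part_fun x)
    (link_part_fun_is_linear x).

Definition link_part x : 'End(chain) := linfun (link_part_fun x).

Lemma link_part_simplex x a :
  link_part x (simplex a) =
    if x \in a then (-1) ^+ position a x *: simplex (a :\ x) else 0.
Proof. by rewrite lfunE /= /link_part_fun sum_simplex_coef. Qed.

Lemma link_part_coef x c b : x \notin b ->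
  link_part x c b = (-1) ^+ position (x |: b) x * c (x |: b).
Proof.
move=> xb; rewrite lfunE /= sum_ffunE (bigD1 (x |: b)) ?setU11 //=.
rewrite !ffunE setU1K // eqxx big1 ?addr0.
  by rewrite /GRing.scale /= mulr1 mulrC.
move=> a /andP[xa nab]; rewrite !ffunE; case: eqP => [ba|_].
  by rewrite ba setD1K // eqxx in nab.
by rewrite /GRing.scale /= !mulr0.
Qed.

(** In the boundary of [x |: a], the face [a] avoids [x] and is killed; on the
other faces the signs differ by [position_swap]. For an edge [[set x; y]] the
link part of the boundary is a multiple of the empty simplex, which is why the
right-hand side needs the augmentation. *)
Lemma link_part_boundary x c :
  link_part x (boundary F T c) = - aug_boundary (link_part x c).
Proof.
have: (link_part x \o boundary F T = - (aug_boundary \o link_part x))%VF.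
  apply: eq_lfun_simplex => a; rewrite opp_lfunE !comp_lfunE link_part_simplex.
  rewrite boundary_simplex; have [xa|xa] := boolP (x \in a); last first.
    rewrite linear0 oppr0; case: ifP => _; rewrite ?linear0 // linear_sum.
    rewrite big1 // => y ya.
    by rewrite linearZ /= link_part_simplex !inE (negPf xa) andbF scaler0.
  rewrite linearZ /= aug_boundary_simplex scaler_sumr.
  have ca := cardsD1 x a; rewrite xa in ca.
  case: ifPn => [_|a1]; last first.
    have a0 : a :\ x = set0.
      by apply/eqP; rewrite -cards_eq0 -leqn0 -ltnS -add1n -ca leqNgt.
    by rewrite linear0 a0 big_set0 oppr0.
  rewrite linear_sum (bigD1 x) //= linearZ /= link_part_simplex !inE eqxx /=.
  rewrite scaler0 add0r -sumrN.
  apply: eq_big => y; first by rewrite !inE andbC.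
  case/andP=> ya yx; rewrite linearZ /= link_part_simplex !inE eq_sym yx xa /=.
  rewrite !scalerA -!exprD position_swap // 1?eq_sym // scaleNr.
  by congr (- (_ *: simplex _)); apply/setP => z; rewrite !inE andbCA.
by move/lfunP/(_ c); rewrite opp_lfunE !comp_lfunE.
Qed.

End Chains.

(** * Homology of a complex relative to the deletion of a vertex *)

Section LinkHomology.
Variables (F : fieldType) (T : finType).
Local Notation simplex := (@simplex F T).
Implicit Types (K : {set {set T}}) (a b : {set T}).

Definition deletion K (x : T) : {set {set T}} := [set a in K | x \notin a].

Lemma deletion_complex K x :
  simplicial_complex K -> simplicial_complex (deletion K x).
Proof.
move=> [K0 Ksub]; split=> [|a b]; rewrite !inE ?K0 // => /andP[aK xa] ba.
by rewrite (Ksub a b) //=; apply: contra xa => /(subsetP ba).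
Qed.

Lemma link_complex K x :
  simplicial_complex K -> x \in vertices K -> simplicial_complex (link K x).
Proof.
move=> [K0 Ksub]; rewrite inE => xK; split=> [|a b].
  by rewrite !inE K0 setU0.
rewrite !inE => /and3P[aK xa xaK] ba; rewrite (Ksub a b) //=.
rewrite (Ksub _ _ xaK) ?setUS // andbT.
by apply: contra xa => /(subsetP ba).
Qed.

Lemma link_part_chains K x i : simplicial_complex K ->
  (link_part F x @: chains F K i.+1)%VS = chains F (link K x) i.
Proof.
move=> [_ Ksub]; apply/eqP; rewrite eqEsubv; apply/andP; split.
  apply/subvP => _ /memv_imgP[c cK ->]; rewrite memv_preim.
  apply: subvP cK; apply: chains_subvP => a aK ai; rewrite -memv_preim.
  rewrite link_part_simplex; case: ifP => [xa|_]; last exact: mem0v.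
  apply/memvZ/simplex_chains; first by
    rewrite !inE setD1K // aK eqxx (Ksub _ _ aK) ?subD1set.
  by apply/eqP; rewrite -eqSS -ai (cardsD1 x a) xa.
apply: chains_subvP => a; rewrite !inE => /and3P[_ xa xaK] ai.
have -> : simplex a =
    link_part F x ((-1) ^+ position (x |: a) x *: simplex (x |: a)).
  by rewrite linearZ /= link_part_simplex setU11 setU1K // scalerA -expr2
     sqrr_sign scale1r.
by apply/memv_img/memvZ/simplex_chains; rewrite // cardsU1 xa ai.
Qed.

Lemma chains_deletion K x i :
  (chains F K i :&: lker (link_part F x))%VS = chains F (deletion K x) i.
Proof.
apply/eqP; rewrite eqEsubv; apply/andP; split.
  apply/subvP => c; rewrite memv_cap memv_ker => /andP[/chainsP cK /eqP c0].
  apply/chainsP => a ca; have /andP[aK ->] := cK a ca; rewrite inE aK andbT /=.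
  apply: contra ca => xa.
  have /(link_part_coef c) : x \notin a :\ x by rewrite setD11.
  rewrite setD1K // c0 ffunE => /esym/eqP.
  by rewrite mulf_eq0 signr_eq0.
apply: chains_subvP => a; rewrite inE => /andP[aK xa] ai.
rewrite memv_cap simplex_chains // memv_ker link_part_simplex (negPf xa).
exact: eqxx.
Qed.

(** Both [rel_cycles] and [rel_boundaries] lie between the chains of the
deletion and those of [K], so passing to link parts lowers their dimensions by
the same amount and preserves the difference. *)
Lemma dim_link_part K x i (W : {vspace chain F T}) :
  (chains F (deletion K x) i <= W)%VS -> (W <= chains F K i)%VS ->
  \dim W = (\dim (chains F (deletion K x) i) + \dim (link_part F x @: W))%N.
Proof.
move=> DW WK; rewrite -(limg_ker_dim (link_part F x) W); congr (\dim _ + _)%N.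
by rewrite -(capv_idPl WK) -capvA chains_deletion; apply/capv_idPr.
Qed.

Definition aug_cycles K i : {vspace chain F T} :=
  (chains F K i :&: lker (aug_boundary F T))%VS.

(** A chain of [K] has its boundary in the deletion exactly when the link part
of that boundary vanishes, that is, when its own link part is an augmented
cycle. *)
Lemma link_part_rel_cycles K x i : simplicial_complex K ->
  (link_part F x @: rel_cycles F K (deletion K x) i.+1)%VS =
    aug_cycles (link K x) i.
Proof.
move=> Kc; apply/eqP; rewrite eqEsubv; apply/andP; split; apply/subvP => e.
  case/memv_imgP => c; rewrite memv_cap -memv_preim /= => /andP[cK dc] ->.
  rewrite memv_cap -link_part_chains // memv_img //= memv_ker.
  by move: dc; rewrite -chains_deletion memv_cap memv_ker link_part_boundary
    oppr_eq0 => /andP[].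
rewrite memv_cap -link_part_chains // => /andP[/memv_imgP[c cK ->]].
rewrite memv_ker => dc; rewrite memv_img // memv_cap cK -memv_preim /=.
by rewrite -chains_deletion memv_cap boundary_chains // memv_ker
  link_part_boundary oppr_eq0.
Qed.

(** The augmented boundary on the right gives the lemma a meaning for
[i = 0] too, where it computes the relative homology in degree 0. *)
Lemma link_part_rel_boundaries K x i : simplicial_complex K ->
  (link_part F x @: rel_boundaries F K (deletion K x) i)%VS =
    (aug_boundary F T @: chains F (link K x) i)%VS.
Proof.
move=> Kc; rewrite limgD.
have /eqP-> : (link_part F x @: chains F (deletion K x) i == 0)%VS.
  by rewrite -lkerE -chains_deletion capvSr.
rewrite addv0 /boundaries -link_part_chains // -!limg_comp.
have bd_link c : (aug_boundary F T \o link_part F x)%VF c =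
    - (link_part F x \o boundary F T)%VF c.
  by rewrite !comp_lfunE link_part_boundary opprK.
apply/eqP; rewrite eqEsubv; apply/andP; split;
  apply/subvP => _ /memv_imgP[c cK ->].
  by rewrite -memvN -bd_link memv_img.
by rewrite bd_link memvN memv_img.
Qed.

Lemma aug_boundaries K i :
  (aug_boundary F T @: chains F K i.+1)%VS = boundaries F K i.
Proof. by apply: eq_in_limg => c; apply: aug_boundary_chains. Qed.

Lemma rel_betti_deletion K x i : simplicial_complex K ->
  rel_betti F K (deletion K x) i.+1 =
    (\dim (aug_cycles (link K x) i) - \dim (boundaries F (link K x) i))%N.
Proof.
move=> Kc; have DK j : (chains F (deletion K x) j <= chains F K j)%VS.
  by rewrite chainsS // /deletion setIdE subsetIl.
rewrite /rel_betti (@dim_link_part K x i.+1); first last.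
- exact: capvSl.
- rewrite subv_cap DK; apply/subvP => c cD; rewrite -memv_preim.
  exact: boundary_chains (deletion_complex x Kc) cD.
rewrite (@dim_link_part K x i.+1 (rel_boundaries _ _ _ _)); first last.
- rewrite subv_add DK andbT; apply/subvP => _ /memv_imgP[c cK ->].
  exact: boundary_chains.
- exact: addvSr.
by rewrite link_part_rel_cycles // link_part_rel_boundaries //
  aug_boundaries subnDl.
Qed.

(** The two endpoints of an edge occur in its boundary with opposite signs.
Together with [dim_cycles0] this makes the truncated subtraction in
[betti F K 0] positive when [K] has a vertex, so that 1 can be taken off it in
[reduced_betti_aug]. *)
Lemma boundaries_aug_cycles0 K :
  simplicial_complex K -> (boundaries F K 0 <= aug_cycles K 0)%VS.
Proof.
move=> Kc; apply/subvP => _ /memv_imgP[c cK ->].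
rewrite memv_cap boundary_chains //= memv_ker -comp_lfunE -memv_ker.
apply: subvP cK; apply: chains_subvP => a _ a2.
rewrite memv_ker comp_lfunE boundary_simplex a2 /= linear_sum /=.
have /cards2P[y [z [yz a_yz]]] : #|a| == 2 by rewrite a2.
have [ya za] : y \in a /\ z \in a by rewrite a_yz !inE !eqxx orbT.
have ay : a :\ y = [set z].
  apply/setP => u; rewrite a_yz !inE.
  by case: (u =P y) => //= ->; rewrite (negPf yz).
have az : a :\ z = [set y].
  apply/setP => u; rewrite a_yz !inE; case: (u =P z) => [->|_] /=.
    by rewrite eq_sym (negPf yz).
  by rewrite orbF.
rewrite (big_setD1 y ya) /= ay big_set1 !linearZ /= az.
rewrite !aug_boundary_vertex (position_setD1 y za) (position_setD1 z ya) ay az.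
rewrite !position_set1 !addn0 -scalerDl.
have: enum_rank y != enum_rank z by rewrite (inj_eq enum_rank_inj).
rewrite -val_eqE /=.
by case: ltngtP => // _ _; rewrite expr0 expr1 ?subrr ?addNr scale0r.
Qed.

Lemma cycles0 K : cycles F K 0 = chains F K 0.
Proof.
apply/capv_idPl/chains_subvP => a _ a1.
by rewrite memv_ker boundary_simplex a1.
Qed.

Lemma cyclesS K i : cycles F K i.+1 = aug_cycles K i.+1.
Proof.
apply/vspaceP => c; rewrite !memv_cap !memv_ker.
by case: (boolP (c \in chains F K i.+1)) => // /aug_boundary_chains ->.
Qed.

Lemma chains0_eq0 K : vertices K = set0 -> chains F K 0 = 0%VS.
Proof.
move=> V0; apply/eqP; rewrite -subv0.
apply: chains_subvP => a aK /eqP/cards1P[v av].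
by have := in_set0 v; rewrite -V0 inE -av aK.
Qed.

Lemma aug_boundary_chains0 K : vertices K != set0 ->
  (aug_boundary F T @: chains F K 0)%VS = <[simplex set0]>%VS.
Proof.
case/set0Pn => v; rewrite inE => vK.
apply/eqP; rewrite eqEsubv; apply/andP; split.
  apply/subvP => _ /memv_imgP[c cK ->]; rewrite memv_preim.
  apply: subvP cK; apply: chains_subvP => a _ /eqP/cards1P[y ->].
  by rewrite -memv_preim aug_boundary_vertex memv_line.
rewrite -memvE -(aug_boundary_vertex F v) memv_img // simplex_chains //.
exact: cards1.
Qed.

Lemma dim_simplex_line a : \dim <[simplex a]>%VS = 1%N.
Proof.
rewrite dim_vline; suff -> : simplex a != 0 by [].
by apply/eqP => /ffunP/(_ a)/eqP; rewrite !ffunE eqxx oner_eq0.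
Qed.

Lemma dim_cycles0 K : vertices K != set0 ->
  \dim (cycles F K 0) = (\dim (aug_cycles K 0)).+1.
Proof.
move=> Vn0; rewrite cycles0 -(limg_ker_dim (aug_boundary F T)) -addn1.
by rewrite aug_boundary_chains0 // dim_simplex_line.
Qed.

(** The right-hand side corrects the convention of [reduced_betti], which is -1
in degree 0 on a complex without vertices, where the homology of the augmented
complex vanishes. *)
Lemma reduced_betti_aug K i : simplicial_complex K ->
  reduced_betti F K i =
    (\dim (aug_cycles K i) - \dim (boundaries F K i))%N%:Z
    - ((vertices K == set0) && (i == 0%N))%:Z.
Proof.
move=> Kc; rewrite /reduced_betti /betti.
case: i => [|i]; last by rewrite cyclesS andbF.
rewrite andbT; have [V0|Vn0] := eqVneq (vertices K) set0; last first.
  rewrite dim_cycles0 // subr0 subSn ?dimvS ?boundaries_aug_cycles0 //.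
  by rewrite intS /= [1 + _]addrC addrK.
by rewrite cycles0 /aug_cycles chains0_eq0 // cap0v.
Qed.

(** The analogue of [rel_betti_link] for reduced homology in degree -1: modulo
the deletion the only 0-chains are the multiples of [x], and [x] is a
relative boundary as soon as it has a neighbour. *)
Lemma rel_betti0_deletion K x : simplicial_complex K -> x \in vertices K ->
  rel_betti F K (deletion K x) 0 = (vertices (link K x) == set0).
Proof.
move=> Kc; rewrite inE => xK.
have DK : (chains F (deletion K x) 0 <= chains F K 0)%VS.
  by rewrite chainsS // /deletion setIdE subsetIl.
have cyc : rel_cycles F K (deletion K x) 0 = chains F K 0.
  apply/capv_idPl/subvP => c; rewrite -cycles0 memv_cap memv_ker.
  by rewrite -memv_preim => /andP[_ /eqP->]; rewrite mem0v.
have lk0 : (link_part F x @: chains F K 0)%VS = <[simplex set0]>%VS.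
  apply/eqP; rewrite eqEsubv; apply/andP; split.
    apply/subvP => _ /memv_imgP[c cK ->]; rewrite memv_preim.
    apply: subvP cK; apply: chains_subvP => a _ /eqP/cards1P[y ->].
    rewrite -memv_preim link_part_simplex inE.
    case: eqP => [<-|_]; last exact: mem0v.
    by rewrite setDv memvZ ?memv_line.
  have -> : simplex set0 =
      link_part F x ((-1) ^+ position [set x] x *: simplex [set x]).
    by rewrite linearZ /= link_part_simplex set11 setDv scalerA -expr2
       sqrr_sign scale1r.
  by rewrite -memvE memv_img // memvZ // simplex_chains // cards1.
rewrite /rel_betti cyc (dim_link_part DK) ?subvv //.
rewrite (@dim_link_part K x 0 (rel_boundaries _ _ _ _)) ?addvSr //; last first.
  rewrite subv_add DK andbT; apply/subvP => _ /memv_imgP[c cK ->].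
  exact: boundary_chains.
rewrite link_part_rel_boundaries // lk0 dim_simplex_line subnDl.
have [V0|Vn0] := eqVneq (vertices (link K x)) set0.
  by rewrite chains0_eq0 // limg0 dimv0.
by rewrite aug_boundary_chains0 // dim_simplex_line.
Qed.

Lemma rel_betti_link K x i : simplicial_complex K -> x \in vertices K ->
  (rel_betti F K (deletion K x) i.+1)%:Z =
    reduced_betti F (link K x) i
    + ((vertices (link K x) == set0) && (i == 0%N))%:Z.
Proof.
move=> Kc xK; rewrite rel_betti_deletion // reduced_betti_aug ?subrK //.
exact: link_complex.
Qed.

End LinkHomology.

(** * Averages over subsets *)

Section SubsetMeans.
Variable T : finType.
Implicit Types (V A B : {set T}) (f g : {set T} -> rat).

(** The sigma-vector has this form, with [V] the vertex set and [f] the reduced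
Betti number of the induced subcomplex; leaving [f] free lets relative Betti
numbers be averaged with the same weights. *)
Definition sum_subset_means V f : rat :=
  \sum_(0 <= j < #|V|.+1) ('C(#|V|, j)%:R)^-1 *
    \sum_(A : {set T} | (A \subset V) && (#|A| == j)) f A.

Lemma eq_sum_subset_means V f g :
  (forall A, A \subset V -> f A = g A) ->
  sum_subset_means V f = sum_subset_means V g.
Proof.
move=> fg; apply: eq_bigr => j _; congr (_ * _).
by apply: eq_bigr => A /andP[/fg].
Qed.

Lemma sum_subset_meansD V f g :
  sum_subset_means V (fun A => f A + g A) =
    sum_subset_means V f + sum_subset_means V g.
Proof.
rewrite /sum_subset_means -big_split; apply: eq_bigr => j _ /=.
by rewrite big_split mulrDr.
Qed.

Lemma sum_subset_means_set0 V (b : bool) :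
  sum_subset_means V (fun A => ((A == set0) && b)%:R) = b%:R.
Proof.
rewrite /sum_subset_means big_nat_recl // bin0 invr1 mul1r.
rewrite [X in _ + X]big1 ?addr0 => [|j _]; last first.
  rewrite big1 ?mulr0 // => A /andP[_]; rewrite -cards_eq0.
  by case: eqP => // ->.
rewrite (bigD1 set0) ?sub0set ?cards0 //= eqxx big1 ?addr0 // => A.
by rewrite cards_eq0; case: eqP => // ->; rewrite ?andbF.
Qed.

Lemma sum_codim1 B f :
  \sum_(A : {set T} | (A \subset B) && (#|B :\: A| == 1%N)) f A =
    \sum_(x in B) f (B :\ x).
Proof.
transitivity (\sum_(A in [set B :\ x | x in B]) f A); last first.
  rewrite big_imset //= => x y xB yB eqxy.
  by have := setD11 x B; rewrite eqxy !inE xB andbT => /negbFE/eqP.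
apply: eq_bigl => A; apply/andP/imsetP => [[AB /cards1P[x BA]]|[x xB ->]].
  exists x; last by rewrite -BA setDDr setDv set0U; apply/esym/setIidPr.
  by have := set11 x; rewrite -BA inE => /andP[].
rewrite subD1set setDDr setDv set0U; split=> //; apply/cards1P; exists x.
by apply/setIidPr; rewrite sub1set.
Qed.

(** For [#|B| = j], removing a point leaves [j.-1] elements of a set with
[#|V|.-1] elements: the weight of [B] is the weight of [A] in
[sum_subset_means (V :\ x)]. *)
Lemma sum_codim1_pairs V (f : {set T} -> {set T} -> rat) :
  \sum_(1 <= j < #|V|.+1) ('C(#|V|.-1, j.-1)%:R)^-1 *
     \sum_(B : {set T} | (B \subset V) && (#|B| == j))
        \sum_(A : {set T} | (A \subset B) && (#|B :\: A| == 1%N)) f B A =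
  \sum_(x in V) sum_subset_means (V :\ x) (fun A => f (x |: A) A).
Proof.
rewrite big_add1 /=.
transitivity (\sum_(x in V) \sum_(0 <= j < #|V|) ('C(#|V|.-1, j)%:R)^-1 *
    \sum_(A : {set T} | (A \subset V :\ x) && (#|A| == j)) f (x |: A) A);
  last first.
  by apply: eq_bigr => x xV; rewrite /sum_subset_means (cardsD1 x V) xV add1n.
rewrite exchange_big; apply: eq_bigr => j _; rewrite -mulr_sumr.
congr (_ * _); under eq_bigr do rewrite sum_codim1.
rewrite (exchange_big_dep (mem V)) /= => [|B x /andP[/subsetP BV _] /BV //].
apply: eq_bigr => x xV.
rewrite (reindex_onto (fun A => x |: A) (fun B => B :\ x)) /=; last first.
  by move=> B /andP[_ /setD1K].
apply: eq_big => [A|A /andP[_ /eqP->]] //; rewrite setU11 andbT subsetD1 subUset.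
rewrite sub1set xV cardsU1; have [xA|xA] := boolP (x \in A); last first.
  by rewrite setU1K // eqxx eqSS !andbT.
rewrite !andbF; apply/negbTE; rewrite negb_and; apply/orP; right.
by apply: contraL xA => /eqP <-; rewrite setD11.
Qed.

End SubsetMeans.

(** * Links and deletions in induced complexes *)

Section InducedLink.
Variable T : finType.
Implicit Types (X : {set {set T}}) (A : {set T}).

Lemma induced_complex X A :
  simplicial_complex X -> simplicial_complex (induced X A).
Proof.
move=> [X0 Xsub]; split=> [|a b]; rewrite !inE ?X0 ?sub0set //.
by move=> /andP[aX aA] ba; rewrite (Xsub a b) // (subset_trans ba).
Qed.

Lemma vertices_induced X A : vertices (induced X A) = A :&: vertices X.
Proof. by apply/setP => v; rewrite !inE sub1set andbC. Qed.

Lemma deletion_induced X x A : x \notin A ->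
  deletion (induced X (x |: A)) x = induced X A.
Proof.
move=> xA; apply/setP => a; rewrite !inE -andbA; congr (_ && _).
by rewrite -(setU1K xA) subsetD1 setU1K.
Qed.

Lemma link_induced X x A : x \notin A ->
  link (induced X (x |: A)) x = induced (link X x) A.
Proof.
move=> xA; apply/setP => a; rewrite !inE subUset sub1set setU11 /=.
rewrite -{3}(setU1K xA) subsetD1.
by case: (a \in X); case: (x \in a); case: (_ \in X); case: (_ \subset _).
Qed.

Lemma vertices_link X x : neighbourly2 X ->
  x \in vertices X -> vertices (link X x) = vertices X :\ x.
Proof.
move=> X2 xV; apply/setP => v; rewrite !inE eq_sym.
have [vX|] := boolP ([set v] \in X); last by rewrite andbF.
by rewrite -[_ |: _]/([set x; v]) X2 // ?inE // !andbT /= eq_sym.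
Qed.

End InducedLink.

Theorem lemma2p4 (F : fieldType) (T : finType) (X : {set {set T}}) (d m : nat)
    (X_complex : simplicial_complex X)
    (X_neighbourly : neighbourly2 X)
    (dimX : dim_complex X = d%:Z)
    (card_vertices : #|vertices X| = m) :
  forall i : nat, (i <= d)%N ->
    mu F X i =
      (m%:R)^-1 * \sum_(1 <= j < m.+1) ('C(m.-1, j.-1)%:R)^-1 *
        \sum_(B : {set T} | (B \subset vertices X) && (#|B| == j))
          \sum_(A : {set T} | (A \subset B) && (#|B :\: A| == 1%N))
            (rel_betti F (induced X B) (induced X A) i)%:R.
Proof.
move=> i _; rewrite -card_vertices.
rewrite (sum_codim1_pairs (vertices X)
  (fun B A => (rel_betti F (induced X B) (induced X A) i)%:R)).
(* A complex without vertices has dimension -1, not a natural number. *)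
have mn0 : #|vertices X|%:R != 0 :> rat.
  rewrite pnatr_eq0 cards_eq0; apply: contraPneq dimX => V0.
  rewrite /dim_complex big1 // => a aX; apply/eqP; rewrite cards_eq0.
  apply: contraT => /set0Pn[v va]; have := in_set0 v; rewrite -V0 inE.
  by rewrite (X_complex.2 a) // sub1set.
have mean1 b :
    (#|vertices X|%:R)^-1 * \sum_(x in vertices X) b%:R = b%:R :> rat.
  by rewrite sumr_const -[X in _ * X]mulr_natl mulKf.
have pair x (A : {set T}) : x \in vertices X -> A \subset vertices X :\ x ->
    [/\ simplicial_complex (induced X (x |: A)),
        x \in vertices (induced X (x |: A)),
        deletion (induced X (x |: A)) x = induced X A,
        link (induced X (x |: A)) x = induced (link X x) A &
        vertices (induced (link X x) A) = A].
  move=> xV; rewrite subsetD1 => /andP[AV xA].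
  split; [exact: induced_complex | by rewrite vertices_induced inE setU11
    | exact: deletion_induced | exact: link_induced |].
  rewrite vertices_induced vertices_link //; apply/setIidPl.
  by rewrite subsetD1 AV.
case: i => [|k] /=.
  rewrite -[LHS](mean1 true); congr (_ * _); apply: eq_bigr => x xV.
  rewrite -(sum_subset_means_set0 (vertices X :\ x) true).
  apply: eq_sum_subset_means => A /(pair x A xV)[Xc xX <- lkE vE].
  by rewrite rel_betti0_deletion // lkE vE andbT.
(* The Kronecker delta is spread over the vertices [x], and then over the terms
   A = set0 of [sum_subset_means]. *)
rewrite eqSS -(mean1 (k == 0%N)) -mulrDr -big_split /=; congr (_ * _).
apply: eq_bigr => x xV; rewrite -(sum_subset_means_set0 (vertices X :\ x)).
rewrite /sigma vertices_link // -sum_subset_meansD.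
apply: eq_sum_subset_means => A /(pair x A xV)[Xc xX <- lkE vE].
by rewrite [RHS](_ : _ = ((rel_betti F (induced X (x |: A))
  (deletion (induced X (x |: A)) x) k.+1)%:Z)%:~R) // rel_betti_link // lkE vE
  [RHS]rmorphD [RHS]addrC.
Qed.
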